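(* Let $K$ and $L$ be finite simplicial complexes. If $K\searrow\!\!\searrow L$, then $\mathcal F_{\mathscr G}(K)\searrow^{d}\mathcal F_{\mathscr G}(L)$.
   Context: Simplicial complexes are finite. A simplicial complex $K$ is a simplicial cone $aL$ if there are a (possibly empty) subcomplex $L$ and a vertex $a$ not in $L$ such that the simplices of $K$ are exactly $\{a\}$, the $\sigma\in L$ and the $\{a\}\cup\sigma$ with $\sigma\in L$. For a vertex $x$ of $K$, $\mathrm{lk}_K(x)=\{\sigma\in K: x\notin\sigma,\ \{x\}\cup\sigma\in K\}$ and $K-x=\{\sigma\in K: x\notin\sigma\}$. The vertex $x$ is dominated by $a$ (dismantlable) in $K$ if $\mathrm{lk}_K(x)$ is a simplicial cone $aK'$ for some subcomplex $K'$. The deletion $K\searrow\!\!\searrow K-x$ of a dismantlable vertex is an elementary strong collapse, and $K\searrow\!\!\searrow L$ means that $L$ is obtained from $K$ by a finite (possibly empty) succession of elementary strong collapses. The face graph $\mathcal F_{\mathscr G}(K)$ is the reflexive graph whose vertices are the nonempty simplices of $K$, with an edge between two simplices iff one contains the other. For a graph $G$ (finite, undirected, no parallel edges, loops allowed), $N_G(x)=\{y: y\sim x\}$; a vertex $x$ is dismantlable if there is a vertex $a\neq x$ with $N_G(x)\subset N_G(a)$. $G\searrow^{d}H$, for a subgraph $H$ of $G$, means: $H$ is the subgraph of $G$ induced by $V(H)$ and one can write $V(G)\setminus V(H)=\{x_1,\dots,x_k\}$ ($k\ge0$, distinct) so that each $x_i$ is dismantlable in the subgraph of $G$ induced by $V(H)\cup\{x_i,\dots,x_k\}$.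 *)

(* Defs.v *)
From HB Require Import structures.
From mathcomp Require Import all_boot.

Set Implicit Arguments.
Unset Strict Implicit.
Unset Printing Implicit Defensive.

Section SimplicialComplexes.
Variable V : finType.

(* Only nonempty faces are required to be simplices, so the empty set may or  *)
(* may not belong to [K]: both usual conventions are covered. [V] is an       *)
(* ambient type: the vertices of [K] are the [x : V] with [[set x] \in K].    *)
Definition is_complex (K : {set {set V}}) : bool :=
  [forall s in K, forall t : {set V}, (t \subset s) && (t != set0) ==> (t \in K)].

Record complex := Complex {
  simplices :> {set {set V}};
  complexP : is_complex simplices
}.

HB.instance Definition _ := [isSub for simplices].

Lemma is_complexP (K : {set {set V}}) :
  reflect (forall s t : {set V}, s \in K -> t \subset s -> t != set0 -> t \in K)
          (is_complex K).
Proof.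
apply: (iffP forall_inP) => [cK s t sK ts t0 | cK s sK].
  by have /forallP/(_ t) := cK s sK; rewrite ts t0.
by apply/forallP=> t; apply/implyP=> /andP[ts t0]; apply: cK sK ts t0.
Qed.

Implicit Types (K L : complex) (a x : V).

Definition link_set K x : {set {set V}} :=
  [set s in simplices K | (x \notin s) && (x |: s \in simplices K)].

Lemma link_subproof K x : is_complex (link_set K x).
Proof.
apply/is_complexP=> s t; rewrite !inE => /and3P[sK xs xsK] ts t0.
have cK := is_complexP _ (complexP K).
rewrite (cK _ _ sK ts t0) (contra (subsetP ts x) xs) /=.
apply: (cK _ _ xsK); first by rewrite setUS.
by apply/set0Pn; exists x; rewrite setU11.
Qed.

Definition link K x : complex := Complex (link_subproof K x).

Definition deletion_set K x : {set {set V}} :=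
  [set s in simplices K | x \notin s].

Lemma deletion_subproof K x : is_complex (deletion_set K x).
Proof.
apply/is_complexP=> s t; rewrite !inE => /andP[sK xs] ts t0.
by rewrite (is_complexP _ (complexP K) _ _ sK ts t0) (contra (subsetP ts x) xs).
Qed.

Definition deletion K x : complex := Complex (deletion_subproof K x).

Definition is_cone K a L : Prop :=
  [set a] \notin simplices L /\
  simplices K =
    [set a] |: (simplices L :|: [set a |: s | s in simplices L]).

Definition dominated_by K x a : Prop :=
  [set x] \in simplices K /\ exists L, is_cone (link K x) a L.

Definition dismantlable_vertex K x : Prop := exists a, dominated_by K x a.

Inductive strong_collapse : complex -> complex -> Prop :=
| strong_collapse_refl K : strong_collapse K K
| strong_collapse_step K x L :
    dismantlable_vertex K x ->
    strong_collapse (deletion K x) L -> strong_collapse K L.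

End SimplicialComplexes.

Section Graphs.
Variable T : finType.

(* Loops are allowed. *)
Record graph := Graph {
  vertices : {set T};
  adj : rel T;
  adj_vertices : forall x y, adj x y -> (x \in vertices) && (y \in vertices);
  adj_sym : symmetric adj
}.

Implicit Types (G H : graph) (S : {set T}) (x : T).

Definition neighbours G x : {set T} := [set y | adj G x y].

Definition induced_adj G S : rel T :=
  fun x y => [&& x \in S, y \in S & adj G x y].

Lemma induced_adj_vertices G S x y :
  induced_adj G S x y ->
  (x \in vertices G :&: S) && (y \in vertices G :&: S).
Proof. by case/and3P=> xS yS /adj_vertices/andP[xG yG]; rewrite !inE xG yG xS. Qed.

Lemma induced_adj_sym G S : symmetric (induced_adj G S).
Proof. by move=> x y; rewrite /induced_adj andbCA (adj_sym G). Qed.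

Definition induced G S : graph :=
  Graph (@induced_adj_vertices G S) (@induced_adj_sym G S).

Definition dismantlable G x : Prop :=
  x \in vertices G /\
  exists a, [/\ a \in vertices G, a != x & neighbours G x \subset neighbours G a].

Definition is_induced_subgraph H G : Prop :=
  vertices H \subset vertices G /\ adj H =2 adj (induced G (vertices H)).

Definition dismantles_to G H : Prop :=
  is_induced_subgraph H G /\
  exists xs : seq T,
    [/\ uniq xs,
        xs =i vertices G :\: vertices H
      & forall s1 x s2, xs = s1 ++ x :: s2 ->
          dismantlable (induced G (vertices H :|: [set:: x :: s2])) x].

End Graphs.

Section FaceGraph.
Variables (V : finType) (K : complex V).

Definition face_vertices : {set {set V}} :=
  [set s in simplices K | s != set0].

Definition face_adj : rel {set V} := fun s t =>
  [&& s \in face_vertices, t \in face_vertices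
    & (s \subset t) || (t \subset s)].

Lemma face_adj_vertices s t :
  face_adj s t -> (s \in face_vertices) && (t \in face_vertices).
Proof. by case/and3P=> -> ->. Qed.

Lemma face_adj_sym : symmetric face_adj.
Proof. by move=> s t; rewrite /face_adj andbCA orbC. Qed.

Definition face_graph : graph {set V} := Graph face_adj_vertices face_adj_sym.

End FaceGraph.

(* Main.v *)
Require Import Defs.
From mathcomp Require Import all_boot.
From mathcomp Require Import zify.

(** An elementary strong collapse deletes a vertex [x] dominated by some [a],
which means that adding [a] to a simplex of [K] through [x] gives a simplex of
[K] again ([dominated_setU1]). The simplices through [x] can then be dismantled
in the face graph in two rounds.

In the first round the simplices [s] that contain [x] but not [a] go, the
largest first. When [s] is removed, every remaining simplex that strictly
contains [s] contains [a], hence contains [a |: s]; every simplex inside [s] is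
inside [a |: s]. So [a |: s] dominates [s].

In the second round the simplices [s] that contain both [x] and [a] go, the
smallest first. When [s] is removed, every remaining simplex strictly inside
[s] avoids [x], hence lies inside [s :\ x]; every simplex containing [s]
contains [s :\ x]. So [s :\ x], which is nonempty because of [a], dominates [s].

Both rounds are expressed by one rank function on simplices, and
[dismantles_to_rank] turns domination relative to a rank into a dismantling
sequence. What remains is [face_graph (deletion K x)], and the elementary
steps are composed by [dismantles_to_trans]. *)

Set Implicit Arguments.
Unset Strict Implicit.
Unset Printing Implicit Defensive.

(** * Dismantling graphs *)

Section Dismantling.
Variable T : finType.
Implicit Types (G H M : graph T) (S : {set T}) (x : T).

(** Graphs carry proofs and a relation given as a function, so two induced
subgraphs that agree are in general only extensionally equal. *)
Lemma eq_dismantlable G H x :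
  vertices G = vertices H -> adj G =2 adj H ->
  dismantlable G x -> dismantlable H x.
Proof.
move=> eqV eqA [xG [a [aG ax sub]]]; split; first by rewrite -eqV.
exists a; split=> //; first by rewrite -eqV.
by apply/subsetP=> y; have /subsetP/(_ y) := sub; rewrite !inE !eqA.
Qed.

Lemma dismantles_to_refl G : dismantles_to G G.
Proof.
split; first split=> // x y.
  rewrite /= /induced_adj; case: (boolP (adj G x y)) => [|_].
    by move/adj_vertices/andP=> [-> ->].
  by rewrite !andbF.
exists [::]; split=> // [x | [] //].
by rewrite setDv inE.
Qed.

Lemma is_induced_subgraph_trans G H M :
  is_induced_subgraph H G -> is_induced_subgraph M H ->
  is_induced_subgraph M G.
Proof.
case=> sHG aHG [sMH aMH]; split; first exact: subset_trans sMH sHG.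
move=> x y; rewrite aMH /= /induced_adj aHG /= /induced_adj.
case: (boolP (x \in vertices M)) => //= /(subsetP sMH) ->.
by case: (boolP (y \in vertices M)) => //= /(subsetP sMH) ->.
Qed.

Lemma dismantlable_induced_sub G H S x :
  is_induced_subgraph H G -> S \subset vertices H ->
  dismantlable (induced H S) x -> dismantlable (induced G S) x.
Proof.
case=> sHG aHG sSH; apply: eq_dismantlable => [|y z] /=.
  by rewrite (setIidPr sSH) (setIidPr (subset_trans sSH sHG)).
rewrite /induced_adj aHG /= /induced_adj.
case: (boolP (y \in S)) => //= /(subsetP sSH) ->.
by case: (boolP (z \in S)) => //= /(subsetP sSH) ->.
Qed.

(** Concatenating the two sequences works because [H] consists of the vertices
of [M] and of the second sequence: at a vertex of the first sequence, the part
that remains is the same for [H] and for [M]. *)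
Lemma dismantles_to_trans G H M :
  dismantles_to G H -> dismantles_to H M -> dismantles_to G M.
Proof.
case=> iHG [xs [uxs exs dxs]] [iMH [ys [uys eys dys]]].
have [sHG _] := iHG; have [sMH _] := iMH.
split; first exact: is_induced_subgraph_trans iHG iMH.
exists (xs ++ ys); split.
- rewrite cat_uniq uxs uys andbT /=; apply/hasPn=> y.
  by rewrite eys exs !inE => /andP[_ ->].
- move=> x; rewrite mem_cat exs eys !inE.
  have := subsetP sHG x; have := subsetP sMH x.
  case: (x \in vertices H); case: (x \in vertices M) => //=.
  by move=> _ ->.
  by move=> /(_ isT).
  by rewrite orbF.
have inMys y : (y \in vertices M) || (y \in ys) = (y \in vertices H).
  by rewrite eys inE; have := subsetP sMH y; case: (y \in vertices M) => //= ->.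
move=> s1 x s2 def.
have [lt_s1 | le_s1] := ltnP (size s1) (size xs).
  have defxs : xs = s1 ++ x :: take (size xs - size s1).-1 s2.
    have := congr1 (take (size xs)) def.
    rewrite take_size_cat // take_cat ltnNge (ltnW lt_s1) /=.
    by rewrite -{1}(prednK (n := size xs - size s1)) ?subn_gt0.
  have defs2 : s2 = take (size xs - size s1).-1 s2 ++ ys.
    move: def; rewrite {1}defxs -catA => /(congr1 (drop (size s1))).
    by rewrite !drop_size_cat // => -[].
  have -> : vertices M :|: [set:: x :: s2] =
            vertices H :|: [set:: x :: take (size xs - size s1).-1 s2].
    apply/setP=> y; rewrite !inE {1}defs2 mem_cat -inMys.
    by rewrite [in LHS]orbA [in LHS]orbC -!orbA orbCA; do !bool_congr.
  exact: dxs defxs.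
have defys : ys = drop (size xs) s1 ++ x :: s2.
  have := congr1 (drop (size xs)) def.
  rewrite drop_size_cat // drop_cat.
  by case: ltngtP le_s1 => // -> _; rewrite subnn drop0 drop_size.
apply: (dismantlable_induced_sub iHG); last exact: dys defys.
apply/subsetP=> y; rewrite -inMys 3!inE defys mem_cat inE.
by case/or3P=> ->; rewrite ?orbT.
Qed.

(** Sorting by rank gives the order of removal: when [x] is removed, all
remaining vertices outside [H] have rank at least [f x]. A dominating vertex
only has to take care of those, and is still present if it lies in [H] or has
a larger rank. *)
Lemma dismantles_to_rank G H (f : T -> nat) :
    is_induced_subgraph H G ->
    (forall x, x \in vertices G :\: vertices H ->
      exists a, [/\ a \in vertices G, a != x,
        (a \in vertices H) || (f x < f a) &
        forall y, adj G x y -> (y \in vertices H) || (f x <= f y) ->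
          adj G a y]) ->
  dismantles_to G H.
Proof.
move=> iHG dom; split=> //.
pose r := relpre f leq.
have r_total : total r by move=> x y; apply: leq_total.
have r_trans : transitive r by move=> y x z; apply: leq_trans.
pose xs := sort r (enum (vertices G :\: vertices H)).
have memxs : xs =i vertices G :\: vertices H.
  by move=> x; rewrite mem_sort mem_enum.
exists xs; split=> //; first by rewrite sort_uniq enum_uniq.
move=> s1 x s2 defxs.
have xGH : x \in vertices G :\: vertices H.
  by rewrite -memxs defxs mem_cat inE eqxx orbT.
have [a [aG ax aHf xa]] := dom x xGH.
have := sort_sorted r_total (enum (vertices G :\: vertices H)).
rewrite -/xs defxs sorted_pairwise // pairwise_cat /=.
case/and4P=> /allrelP s1_le _ x_le _.
have aS : a \in vertices H :|: [set:: x :: s2].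
  rewrite 2!inE; case: (boolP (a \in vertices H)) aHf => //= aH xfa.
  have : a \in xs by rewrite memxs inE aH aG.
  rewrite defxs mem_cat => /orP[as1 | //].
  have := s1_le a x as1 (mem_head _ _).
  by rewrite /r /= leqNgt xfa.
split.
  by rewrite /= inE; case/setDP: (xGH) => -> _; rewrite !inE eqxx orbT.
exists a; split=> //; first by rewrite inE aG aS.
apply/subsetP=> y; rewrite !inE /= /induced_adj aS => /and3P[_ yS xy].
rewrite yS xa //; move: yS; rewrite !inE.
case/or3P=> [-> // | /eqP -> | ys2]; first by rewrite leqnn orbT.
by have /allP/(_ y ys2) := x_le; rewrite /r /= => ->; rewrite orbT.
Qed.

End Dismantling.

(** * Face graphs and strong collapses *)

Section StrongCollapse.
Variable V : finType.
Implicit Types (K L : complex V) (a x : V) (s t : {set V}).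

Lemma face_adjE K s t :
  adj (face_graph K) s t =
  [&& s \in vertices (face_graph K), t \in vertices (face_graph K)
    & (s \subset t) || (t \subset s)].
Proof. by []. Qed.

Lemma face_vertices_deletion K x s :
  (s \in vertices (face_graph (deletion K x))) =
  (s \in vertices (face_graph K)) && (x \notin s).
Proof. by rewrite !inE andbAC. Qed.

Lemma face_graph_deletion K x :
  is_induced_subgraph (face_graph (deletion K x)) (face_graph K).
Proof.
split; first by apply/subsetP=> s; rewrite face_vertices_deletion => /andP[].
move=> s t; rewrite [RHS]/= /induced_adj !face_adjE !face_vertices_deletion.
by case: (s \in vertices _); case: (t \in vertices _); rewrite ?andbF.
Qed.

Lemma dominated_neq K x a : dominated_by K x a -> a != x.
Proof.
case=> _ [L [_ defL]]; have : [set a] \in simplices (link K x).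
  by rewrite defL setU11.
by rewrite !inE eq_sym => /and3P[].
Qed.

(** Apart from [x] itself, a simplex through [x] is [x] joined to a simplex of
the link, and a cone is closed under adding its apex. *)
Lemma dominated_setU1 K x a s :
  dominated_by K x a -> s \in simplices K -> x \in s ->
  a |: s \in simplices K.
Proof.
case=> _ [L [_ defL]] sK xs.
suff: a |: (s :\ x) \in simplices (link K x).
  by rewrite inE setUCA setD1K // => /and3P[].
have [-> | s0] := eqVneq (s :\ x) set0; first by rewrite setU0 defL setU11.
have : s :\ x \in simplices (link K x).
  rewrite inE setD11 setD1K // sK /= andbT.
  exact: is_complexP (complexP K) _ _ sK (subD1set s x) s0.
rewrite defL !inE => /or3P[/eqP-> | sL | /imsetP[t tL ->]].
- by rewrite setUid eqxx.
- by rewrite imset_f ?orbT.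
- by rewrite setUA setUid imset_f ?orbT.
Qed.

Lemma face_graph_elementary_collapse K x :
  dismantlable_vertex K x ->
  dismantles_to (face_graph K) (face_graph (deletion K x)).
Proof.
case=> a dom; have ax := dominated_neq dom.
(* The simplices without [a] come first, by decreasing size, and then those
   with [a], by increasing size; the shift by #|V| separates the rounds. *)
pose f s := if a \in s then #|V| + #|s| else #|V| - #|s|.
apply: (dismantles_to_rank (f := f)) (face_graph_deletion K x) _ => s.
rewrite inE face_vertices_deletion => /andP[xs sK].
have {}xs : x \in s by move: xs; rewrite sK negbK.
have [sinK s0] : s \in simplices K /\ s != set0 by move: sK; rewrite inE => /andP.
have s_gt0 : 0 < #|s| by rewrite card_gt0.
case: (boolP (a \in s)) => [as_ | as_].
- have aD : a \in s :\ x by rewrite !inE ax.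
  have DK : s :\ x \in vertices (face_graph K).
    have D0 : s :\ x != set0 by apply/set0Pn; exists a.
    rewrite inE D0 andbT.
    exact: is_complexP (complexP K) _ _ sinK (subD1set s x) D0.
  exists (s :\ x); split=> //.
  + by apply/eqP=> /setP/(_ x); rewrite setD11 xs.
  + by rewrite face_vertices_deletion DK setD11.
  (* A remaining [t] through [x] contains [a] and is at least as large as [s]. *)
  move=> t; rewrite !face_adjE face_vertices_deletion DK => /and3P[_ tK st].
  rewrite tK /= => rank_t.
  case/orP: st => [st | ts]; first by rewrite (subset_trans (subD1set s x) st).
  rewrite subsetD1 ts /=.
  case: (boolP (x \in t)) rank_t => [xt /= | _ _]; last by rewrite orbT.
  rewrite /f as_; case: (boolP (a \in t)) => [_ | _]; last by lia.
  rewrite leq_add2l => le_st.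
  have -> : t = s by apply/eqP; rewrite eqEcard ts.
  by rewrite subD1set.
have UK : a |: s \in vertices (face_graph K).
  rewrite inE (dominated_setU1 dom) //.
  by apply/set0Pn; exists a; rewrite setU11.
exists (a |: s); split=> //.
- by apply: contraNneq as_ => <-; rewrite setU11.
- by rewrite /f setU11 (negbTE as_) cardsU1 as_; apply/orP; right; lia.
(* A remaining [t] through [x] contains [a] or is at most as large as [s]. *)
move=> t; rewrite !face_adjE face_vertices_deletion UK => /and3P[_ tK st].
rewrite tK /= => rank_t.
case/orP: st => [st | ts]; last by rewrite (subset_trans ts (subsetUr _ _)) orbT.
rewrite subUset sub1set st andbT.
case: (boolP (a \in t)) => //= at_; move: rank_t.
rewrite (subsetP st x xs) /f (negbTE as_) (negbTE at_) /= => le_ts.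
have -> : t = s.
  apply/esym/eqP; rewrite eqEcard st /=.
  by move: le_ts; rewrite leq_sub2lE // max_card.
exact: subsetUr.
Qed.

End StrongCollapse.

Theorem theorem4p2 (V : finType) (K L : complex V) :
  strong_collapse K L -> dismantles_to (face_graph K) (face_graph L).
Proof.
elim=> {K L} [K | K x L xK _ IH]; first exact: dismantles_to_refl.
exact: dismantles_to_trans (face_graph_elementary_collapse xK) IH.
Qed.
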